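(* Let $p$ be a real number with $1<p<2$, let $d\geq 1$ be an integer, and let \[k=\left\lceil\frac{\log\left((1-2^{p-2})^{-1}\right)}{\log 2}\right\rceil-1.\] Then \[e(\ell_p^d)\geq \left\lfloor\frac{2^{k+1}}{2^{k+1}-1}\,d\right\rfloor.\] In particular, if $d\geq 2^{k+2}-2$ then $e(\ell_p^d)>d+1$.
   Context: For $1<p<\infty$ and an integer $d\geq 1$, $\ell_p^d$ denotes $\mathbb{R}^d$ endowed with the norm $\|x\|_p=\left(\sum_{i=1}^d|x_i|^p\right)^{1/p}$. A set $S\subset \ell_p^d$ is $\lambda$-equilateral ($\lambda>0$) if $\|x-y\|_p=\lambda$ for all distinct $x,y\in S$, and equilateral if it is $\lambda$-equilateral for some $\lambda>0$. The maximum number of elements in an equilateral set in $\ell_p^d$ is denoted by $e(\ell_p^d)$. *)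

(* Defs.v *)
From HB Require Import structures.
From mathcomp Require Import all_boot all_order all_algebra.
From mathcomp Require Import all_classical all_reals all_analysis.
From mathcomp Require Import lra.
Set Implicit Arguments.
Unset Strict Implicit.
Unset Printing Implicit Defensive.
Import Order.TTheory GRing.Theory Num.Theory.

Local Open Scope classical_set_scope.
Local Open Scope ring_scope.

Definition lpnorm (R : realType) (p : R) (d : nat) (x : 'rV[R]_d) : R :=
  (\sum_(i < d) `|x 0 i| `^ p) `^ p^-1.

Definition lambda_equilateral (R : realType) (p : R) (d : nat) (lambda : R)
    (S : set 'rV[R]_d) : Prop :=
  forall x y, S x -> S y -> x <> y -> lpnorm p (x - y) = lambda.

Definition equilateral (R : realType) (p : R) (d : nat)
    (S : set 'rV[R]_d) : Prop :=
  exists2 lambda : R, 0 < lambda & lambda_equilateral p lambda S.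

Definition is_max_equilateral (R : realType) (p : R) (d n : nat) : Prop :=
  (exists2 S : set 'rV[R]_d, equilateral p S & (S #= `I_n)%card) /\
  (forall S : set 'rV[R]_d, equilateral p S -> (S #<= `I_n)%card).

(* The default value 0 is never used when 1 <= p: see [max_equilateralP]. *)
Definition max_equilateral (R : realType) (p : R) (d : nat) : nat :=
  xget 0%N [set n | is_max_equilateral p d n].

Lemma lpnorm_powR (R : realType) (p : R) (d : nat) (x : 'rV[R]_d) :
  1 <= p -> lpnorm p x `^ p = \sum_(i < d) `|x 0 i| `^ p.
Proof.
move=> p1; have p0 : p != 0 by rewrite gt_eqF// (lt_le_trans ltr01).
rewrite /lpnorm -powRrM mulVf// powRr1 ?sumr_ge0// => i _; exact: powR_ge0.
Qed.

Lemma equilateral_bounded (R : realType) (p : R) (d : nat) : 1 <= p ->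
  exists N : nat, forall S : set 'rV[R]_d, equilateral p S -> (S #<= `I_N)%card.
Proof.
move=> p1; have p0 : 0 < p by rewrite (lt_le_trans ltr01).
pose M := (d.+1.*2).+1.
have /finite_setP[N TN] := @finite_finset {ffun 'I_d -> 'I_M} setT.
exists N => S [l l0 Sl].
have [[x0 Sx0]|/forallNP S0] := pselect (exists x, S x); last first.
  by rewrite (_ : S = set0) ?card_le0x//; apply/seteqP; split=> // x /S0.
have lN : l != 0 by rewrite gt_eqF.
have coord x y i : S x -> S y -> `|x 0 i - y 0 i| <= l.
  move=> Sx Sy; have [->|/eqP xy] := eqVneq x y; first by rewrite subrr normr0 ltW.
  rewrite leNgt; apply/negP => lxy.
  have := gt0_ltr_powR p0 (ltW l0) (normr_ge0 _) lxy.
  apply/negP; rewrite -leNgt.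
  rewrite -(Sl _ _ Sx Sy xy) lpnorm_powR// (bigD1 i)//= !mxE lerDl.
  by apply: sumr_ge0 => j _; exact: powR_ge0.
pose t (x : 'rV[R]_d) i := ((x 0 i - x0 0 i) / l + 1) * d.+1%:R.
have t_ge0 x i : S x -> 0 <= t x i.
  move=> Sx; have /ler_normlP[h _] := coord _ _ i Sx Sx0.
  rewrite mulr_ge0// -lerBlDr sub0r ler_pdivlMr// mulN1r.
  by rewrite lerNl.
have t_lt x i : S x -> t x i < M%:R.
  move=> Sx; have /ler_normlP[_ h] := coord _ _ i Sx Sx0.
  rewrite (@le_lt_trans _ _ (2 * d.+1%:R))// ?ler_pM2r//.
    by rewrite (_ : 2 = 1 + 1)// lerD2r ler_pdivrMr// mul1r.
  by rewrite -natrM ltr_nat mul2n.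
pose f x : {ffun 'I_d -> 'I_M} := [ffun i => inord (Num.truncn (t x i))].
have fE x i : S x -> f x i = Num.truncn (t x i) :> nat.
  by move=> Sx; rewrite ffunE inordK// truncn_lt_nat ?t_lt ?t_ge0.
have finj : {in S &, injective f}.
  move=> x y /set_mem Sx /set_mem Sy fxy; apply: contrapT => xy.
  have close i : `|x 0 i - y 0 i| <= l / d.+1%:R.
    have : `|t x i - t y i| <= 1.
      have e : Num.truncn (t x i) = Num.truncn (t y i) by rewrite -!fE// fxy.
      have /andP[a b] := truncn_itv (t_ge0 _ i Sx).
      have /andP[a' b'] := truncn_itv (t_ge0 _ i Sy).
      rewrite e -natr1 in a b; rewrite -natr1 in b'.
      by rewrite ler_norml; apply/andP; split; lra.
    rewrite /t -mulrBl opprD addrACA subrr addr0 -mulrBl opprB addrA subrK.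
    rewrite normrM normrM normfV (gtr0_norm l0) normr_nat.
    by rewrite -ler_pdivlMr// mul1r ler_pdivrMr// mulrC.
  have := lpnorm_powR (x - y) p1; rewrite (Sl _ _ Sx Sy xy) => e.
  have : \sum_(i < d) `|(x - y) 0 i| `^ p <= \sum_(i < d) l `^ p / d.+1%:R.
    apply: ler_sum => i _; rewrite !mxE.
    apply: (@le_trans _ _ ((l / d.+1%:R) `^ p)).
      by rewrite ge0_ler_powR ?nnegrE ?(ltW p0)// divr_ge0// ltW.
    rewrite (powRM _ (ltW l0)) ?invr_ge0//; apply: ler_wpM2l; first exact: powR_ge0.
    by apply: ge1r_powR; rewrite // invr_gt0 ltr0n invf_le1 ?ler1n ?ltr0n.
  rewrite -e sumr_const card_ord -[leRHS]mulr_natr -mulrA leNgt => /negP; apply.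
  rewrite -[ltRHS]mulr1 ltr_pM2l ?powR_gt0// mulrC ltr_pdivrMr// mul1r.
  by rewrite ltr_nat.
rewrite -(card_le_eql (inj_card_eq finj)) -(card_le_eqr TN).
exact: subset_card_le.
Qed.

Lemma max_equilateralP (R : realType) (p : R) (d : nat) : 1 <= p ->
  is_max_equilateral p d (max_equilateral p d).
Proof.
move=> p1; have [N SN] := equilateral_bounded d p1.
pose P n := `[< exists2 S : set 'rV[R]_d, equilateral p S & (S #= `I_n)%card >].
have P0 : exists n, P n.
  exists 0%N; apply/asboolP; exists set0; first by exists 1.
  by rewrite II0.
have PN n : P n -> (n <= N)%N.
  by move=> /asboolP[S /SN SN' Sn]; rewrite -card_le_II -(card_le_eql Sn).
case: (ex_maxnP P0 PN) => m /asboolP Pm mmax.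
rewrite /max_equilateral; case: xgetP => // /(_ m) []; split=> // S eS.
have /finite_setP[n Sn] : finite_set S by apply/finite_set_leP; exists N; exact: SN.
by rewrite (card_le_eql Sn) card_le_II; apply: mmax; apply/asboolP; exists S.
Qed.

(* Main.v *)
Require Import Defs.
From mathcomp Require Import all_boot all_order all_algebra.
From mathcomp Require Import all_classical all_reals all_analysis.
From mathcomp Require Import ring lra zify.
Import Order.TTheory GRing.Theory Num.Theory.
Import numFieldNormedType.Exports.
Local Open Scope ring_scope.

(** Call a family of points of l_p^d balanced if all points have the same norm,
    all distances between two of them are equal, and the p-th power of that
    distance is twice the p-th power of that norm; after rescaling, 2 and 1.
    Two balanced families placed in complementary coordinate subspaces form
    again a balanced family, since the p-th power of a distance across the two
    is 1 + 1 ([has_balancedD]).  With a balanced family of m + 1 points in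
    dimension m = 2^(k+1) - 1 at hand, q copies of it and d - q m single unit
    vectors give d + q points in dimension d as soon as q m <= d, and
    d + floor (d / m) is the claimed bound ([balanced_copies_leq_max]).

    It remains to find a balanced family of 2n points in dimension 2n - 1,
    where n = 2^k.  Let H be a skew Hadamard matrix of order n: entries 1 and
    -1, orthogonal rows, H + H^T = 2 I.  Its rows, normalised so that column 0
    is constant and with that column deleted, are n equidistant vectors w_u in
    dimension n - 1.  For 0 <= t <= 1 let f_u be row u of H with all entries off
    the diagonal multiplied by t.  Skewness makes the distances between f_u and
    f_v and between f_u and - f_v equal, with a value independent of the pair
    u, v ([powsum_shrunk_rowB]).  Therefore the 2n points (a w_u, f_u) and
    (a w_u, - f_u) are equidistant for a suitable a = a(t), and they all have
    the same norm.  At t = 0 the ratio distance^p / norm^p is at least 2, and at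
    t = 1 it is at most 2: the two inequalities amount to n (1 - 2^(p-2)) <= 1 and
    1 <= 2n (1 - 2^(p-2)), which is exactly how k is chosen ([log2_bounds]).
    The intermediate value theorem gives a t with ratio 2
    ([exists_balancing_parameters], [has_balanced_skew]). *)

(** * Balanced families *)

Set Implicit Arguments.
Unset Strict Implicit.

Definition powsum (R : realType) (p : R) (d : nat) (x : 'rV[R]_d) : R :=
  \sum_(i < d) `|x 0 i| `^ p.

Section PowerSums.
Variables (R : realType) (p : R).
Hypothesis p_gt0 : 0 < p.

Lemma powsum0 d : powsum p (0 : 'rV[R]_d) = 0.
Proof.
by apply: big1 => i _; rewrite mxE normr0 powR0 // gt_eqF.
Qed.

Lemma powsumN d (x : 'rV[R]_d) : powsum p (- x) = powsum p x.
Proof. by apply: eq_bigr => i _; rewrite mxE normrN. Qed.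

Lemma powsumZ d a (x : 'rV[R]_d) :
  powsum p (a *: x) = `|a| `^ p * powsum p x.
Proof.
by rewrite mulr_sumr; apply: eq_bigr => i _; rewrite mxE normrM powRM.
Qed.

Lemma powsum_row_mx d1 d2 (x : 'rV[R]_d1) (y : 'rV[R]_d2) :
  powsum p (row_mx x y) = powsum p x + powsum p y.
Proof.
rewrite /powsum big_split_ord; congr (_ + _).
  by apply: eq_bigr => i _; rewrite row_mxEl.
by apply: eq_bigr => i _; rewrite row_mxEr.
Qed.

(** The normalisation of the norm to 1 makes balanced families of different
    origin fit together; [has_balanced_rescale] provides it. *)
Definition has_balanced (d N : nat) : Prop :=
  exists (I : finType) (X : I -> 'rV[R]_d),
    [/\ #|I| = N,
        forall i, powsum p (X i) = 1
      & forall i j, i != j -> powsum p (X i - X j) = 2].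

Lemma has_balanced_rescale d (I : finType) (X : I -> 'rV[R]_d) (r : R) :
  0 < r -> (forall i, powsum p (X i) = r) ->
  (forall i j, i != j -> powsum p (X i - X j) = 2 * r) ->
  has_balanced d #|I|.
Proof.
move=> r0 Xr Xd; pose a := r^-1 `^ p^-1.
have ap : `|a| `^ p = r^-1.
  rewrite ger0_norm ?powR_ge0 // -powRrM mulVf ?gt_eqF // powRr1 //.
  by rewrite invr_ge0 ltW.
exists I, (fun i => a *: X i); split => // [i|i j ij].
  by rewrite powsumZ ap Xr mulVf // gt_eqF.
by rewrite -scalerBr powsumZ ap Xd // mulrCA mulVf ?mulr1 // gt_eqF.
Qed.

Lemma has_balanced0 : has_balanced 0 0.
Proof. by exists void, (fun=> 0); rewrite card_void; split => // -[]. Qed.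

Lemma has_balanced1 : has_balanced 1 1.
Proof.
exists unit, (fun=> const_mx 1); rewrite card_unit; split => // -[].
by rewrite /powsum big_ord1 mxE normr1 powR1.
Qed.

(** A point of the first family and one of the second have disjoint supports, so
    their difference has power sum 1 + 1 = 2, the value already imposed inside
    each family. *)
Lemma has_balancedD d1 N1 d2 N2 :
  has_balanced d1 N1 -> has_balanced d2 N2 -> has_balanced (d1 + d2) (N1 + N2).
Proof.
move=> [I [X [<- X1 X2]]] [J [Y [<- Y1 Y2]]].
exists (I + J)%type, (fun z => match z with
  | inl i => row_mx (X i) 0 | inr j => row_mx 0 (Y j) end).
split; first by rewrite card_sum.
  by case=> [i|j]; rewrite powsum_row_mx powsum0 ?addr0 ?add0r.
case=> [i|i] [j|j] ij; rewrite opp_row_mx add_row_mx powsum_row_mx.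
- by rewrite subrr powsum0 addr0 X2.
- by rewrite oppr0 addr0 add0r powsumN X1 Y1.
- by rewrite oppr0 addr0 add0r powsumN X1 Y1.
- by rewrite subrr powsum0 add0r Y2.
Qed.

Lemma has_balancedM q d N : has_balanced d N -> has_balanced (q * d) (q * N).
Proof.
move=> dN; elim: q => [|q IHq]; first exact: has_balanced0.
by rewrite !mulSn; apply: has_balancedD.
Qed.

Lemma has_balanced_leq_max d N :
  1 <= p -> has_balanced d N -> (N <= max_equilateral p d)%N.
Proof.
move=> p1 [I [X [<- _ X2]]].
pose Y (k : 'I_#|I|) := X (enum_val k).
have Y2 i j : i <> j -> powsum p (Y i - Y j) = 2.
  by move=> /eqP ij; rewrite X2 // (inj_eq enum_val_inj).
have Y_inj : injective Y.
  move=> i j Yij; apply: contrapT => /Y2 /eqP.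
  by rewrite Yij subrr powsum0 eq_sym pnatr_eq0.
have YE : (range Y #= `I_#|I|)%card.
  by rewrite (card_eql (inj_card_eq (in2W Y_inj))) card_eq_sym card_II.
rewrite -card_le_II -(card_le_eql YE).
have [_] := @max_equilateralP R p d p1; apply.
exists (2 `^ p^-1); first exact: powR_gt0.
move=> _ _ [i _ <-] [j _ <-] Yij; rewrite /lpnorm -/(powsum p _) Y2 //.
by move=> ij; rewrite ij in Yij.
Qed.

End PowerSums.

(** * Skew Hadamard matrices *)

Section SkewHadamard.
Variable R : realDomainType.

Definition skew_hadamard (n : nat) (H : 'M[R]_n) : Prop :=
  [/\ forall i j, H i j ^+ 2 = 1, H + H^T = 2%:M & H *m H^T = n%:R%:M].

(** The off-diagonal blocks H and - H^T of the doubled matrix are skew to each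
    other, and its two block rows are orthogonal because their inner product
    is - H H + H H. *)
Lemma skew_hadamard_double n (H : 'M[R]_n) :
  skew_hadamard H -> skew_hadamard (block_mx H H (- H^T) H^T).
Proof.
move=> [H1 H2 H3].
(* H commutes with its transpose, a polynomial in H. *)
have HT : H^T = 2%:M - H by rewrite -H2 addrC addKr.
have H4 : H^T *m H = n%:R%:M.
  rewrite -H3 {1}HT [in RHS]HT mulmxBl mulmxBr.
  by rewrite mul_mx_scalar mul_scalar_mx.
split.
- move=> i j; rewrite !mxE; case: splitP => i' _; rewrite !mxE;
    by case: splitP => j' _; rewrite ?mxE ?sqrrN H1.
- rewrite tr_block_mx add_block_mx linearN /= trmxK (addrC H^T) H2 !subrr.
  by rewrite addNr -scalar_mx_block.
- rewrite tr_block_mx mulmx_block linearN /= trmxK !mulmxN !mulNmx H3 H4.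
  by rewrite opprK !addNr natrD scalar_mx_block raddfD.
Qed.

Lemma skew_hadamard_exists k : exists H : 'M[R]_(2 ^ k), skew_hadamard H.
Proof.
elim: k => [|k [H /skew_hadamard_double]].
  exists 1%:M; split => [i j||]; first by rewrite !ord1 mxE expr1n.
    by rewrite tr_scalar_mx -raddfD.
  by rewrite tr_scalar_mx mulmx1.
by move=> H2; rewrite expnS mul2n -addnn; exists (block_mx H H (- H^T) H^T).
Qed.

Section Entries.
Variables (n : nat) (H : 'M[R]_n).
Hypothesis skH : skew_hadamard H.

Lemma skew_hadamard_diag u : H u u = 1.
Proof.
have [_ /matrixP/(_ u u)] := skH; rewrite !mxE eqxx /=; lra.
Qed.

Lemma skew_hadamard_skew u v : u != v -> H v u = - H u v.
Proof.
move=> uv; have [_ /matrixP/(_ u v)] := skH.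
rewrite !mxE (negbTE uv) /=; lra.
Qed.

Lemma skew_hadamard_orth u v : u != v -> \sum_i H u i * H v i = 0.
Proof.
move=> uv; have [_ _ /matrixP/(_ u v)] := skH.
rewrite !mxE (negbTE uv) mulr0n.
by apply: etrans; apply: eq_bigr => i _; rewrite mxE.
Qed.

Lemma skew_hadamard_sign u v : H u v = 1 \/ H u v = -1.
Proof.
have [/(_ u v)/eqP + _ _] := skH.
by rewrite sqrf_eq1 => /orP[] /eqP; [left|right].
Qed.
End Entries.
End SkewHadamard.

(** * Two families of vectors from the rows of a skew Hadamard matrix *)

Section SkewFrame.
Variables (R : realType) (p : R).
Hypothesis p_gt0 : 0 < p.

(** For signs a and b the p-th power of the distance is affine in a * b, so that
    sums over a pair of orthogonal rows can be evaluated. *)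
Lemma sign_powR (a b : R) : (a = 1 \/ a = -1) -> (b = 1 \/ b = -1) ->
  `|a - b| `^ p = 2 `^ p / 2 * (1 - a * b).
Proof.
have p0 : p != 0 by rewrite gt_eqF.
have n2 : `|- (2 : R)| = 2 by rewrite normrN normr_nat.
have e1 : 1 + 1 = 2 :> R by lra.
have e2 : -1 - 1 = -2 :> R by lra.
by move=> [] -> [] ->; rewrite ?subrr ?opprK ?e1 ?e2 ?normr0 ?powR0 ?n2
  ?normr_nat //; lra.
Qed.

Variables (n' : nat).
Let n := n'.+1.
Variable H : 'M[R]_n.
Hypothesis skH : skew_hadamard H.
Let HS := skew_hadamard_sign skH.

(** Row u multiplied by its sign in column 0; that column, now constant, is
    dropped, because it does not contribute to distances. *)
Definition normalized_row (u : 'I_n) : 'rV[R]_n' :=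
  \row_i (H u 0 * H u (lift 0 i)).

Definition shrunk_row (t : R) (u : 'I_n) : 'rV[R]_n :=
  \row_i (if i == u then 1 else t * H u i).

Lemma powsum_normalized_row u : powsum p (normalized_row u) = n'%:R.
Proof.
rewrite /powsum (eq_bigr (fun=> 1)) ?sumr_const ?card_ord // => i _.
rewrite mxE normrM.
by case: (HS u 0) => ->; case: (HS u (lift 0 i)) => ->;
  rewrite ?normrN normr1 mulr1 powR1.
Qed.

Lemma powsum_normalized_rowB u v : u != v ->
  powsum p (normalized_row u - normalized_row v) = 2 `^ p / 2 * n%:R.
Proof.
move=> uv.
have S2 a b c : H a b * H a c = 1 \/ H a b * H a c = -1.
  by case: (HS a b) => ->; case: (HS a c) => ->;
    rewrite ?mulrN ?mulr1 ?opprK; auto.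
have -> : powsum p (normalized_row u - normalized_row v)
        = \sum_i `|H u 0 * H u i - H v 0 * H v i| `^ p.
  have sq w : H w 0 * H w 0 = 1 by case: (HS w 0) => ->; lra.
  rewrite [RHS]big_ord_recl !sq subrr normr0 powR0 ?gt_eqF // add0r.
  by apply: eq_bigr => i _; rewrite !mxE.
under eq_bigr => i _ do rewrite sign_powR // mulrACA.
rewrite -mulr_sumr sumrB -?mulr_sumr (skew_hadamard_orth skH) //.
by rewrite mulr0 subr0 sumr_const card_ord.
Qed.

Lemma powsum_shrunk_row t u : 0 <= t ->
  powsum p (shrunk_row t u) = 1 + n'%:R * t `^ p.
Proof.
move=> t0; rewrite /powsum (bigD1 u) //= mxE eqxx normr1 powR1.
congr (_ + _).
have tE i : i != u -> `|shrunk_row t u 0 i| `^ p = t `^ p.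
  move=> iu; rewrite mxE (negbTE iu) normrM (ger0_norm t0).
  by case: (HS u i) => ->; rewrite ?normrN normr1 mulr1.
rewrite (eq_bigr _ tE) sumr_const mulr_natl; congr (_ *+ _).
by rewrite cardC1 card_ord.
Qed.

(** Off columns u and v the entries are t times signs, and orthogonality of rows
    u and v makes those two columns cancel in the sum of products, by
    skewness; the remaining n - 2 columns agree and disagree equally often.
    In columns u and v the contributions are (1 - t)^p and (1 + t)^p in some
    order, again by skewness. *)
Lemma powsum_shrunk_rowB t (e : R) u v :
  0 <= t <= 1 -> (e = 1 \/ e = -1) -> u != v ->
  powsum p (shrunk_row t u - e *: shrunk_row t v)
  = t `^ p * (2 `^ p / 2) * (n%:R - 2) + (1 - t) `^ p + (1 + t) `^ p.
Proof.
move=> /andP[t0 t1] eS uv.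
(* G extends the value of the generic columns to columns u and v. *)
pose G i := t `^ p * (2 `^ p / 2) * (1 - e * (H u i * H v i)).
have GE i : (i != u) && (i != v) ->
    `|(shrunk_row t u - e *: shrunk_row t v) 0 i| `^ p = G i.
  move=> /andP[iu iv]; rewrite !mxE (negbTE iu) (negbTE iv) mulrCA -mulrBr.
  rewrite normrM (ger0_norm t0) powRM // /G -mulrA; congr (_ * _).
  rewrite sign_powR //; first by rewrite mulrCA.
  case: eS => ->; rewrite ?mul1r ?mulN1r //.
  by case: (HS v i) => ->; rewrite ?opprK; auto.
have sumG : \sum_i G i = t `^ p * (2 `^ p / 2) * n%:R.
  rewrite -mulr_sumr sumrB -?mulr_sumr (skew_hadamard_orth skH) //.
  by rewrite mulr0 subr0 sumr_const card_ord.
have vu : v != u by rewrite eq_sym.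
have Hvu := skew_hadamard_skew skH uv.
move: sumG; rewrite /powsum (bigD1 u) // (bigD1 v) //= => sumG.
rewrite (bigD1 u) // (bigD1 v) //= (eq_bigr _ GE).
have {sumG} -> : \sum_(i | (i != u) && (i != v)) G i
    = t `^ p * (2 `^ p / 2) * (n%:R - 2).
  rewrite mulrBr -sumG /G Hvu !(skew_hadamard_diag skH); ring.
rewrite addrA [LHS]addrC -[RHS]addrA; congr (_ + _).
rewrite !mxE !eqxx (negbTE uv) (negbTE vu) Hvu.
have t1' : 0 <= 1 - t by lra.
have t2' : 0 <= 1 + t by lra.
rewrite -[in RHS](ger0_norm t1') -[in RHS](ger0_norm t2').
have N1 : - t - 1 = - (1 + t) by ring.
have N2 : t - 1 = - (1 - t) by ring.
(* Each of the four sign patterns yields the same two summands. *)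
case: eS => ->; case: (HS u v) => ->;
  rewrite ?(mul1r, mulr1, mulrN, mulNr, mulN1r, opprK).
- by rewrite N2 normrN addrC.
- by rewrite N1 normrN.
- by rewrite (addrC t).
- by rewrite (addrC (- t)) addrC.
Qed.

End SkewFrame.

(** * Choosing the two parameters of the construction *)

Section Tuning.
Variables (R : realType) (p : R).

(** Away from 0 the function is expR (p * ln `|x|); at 0 it is squeezed between
    0 and `|x|, which needs p >= 1. *)
Lemma continuous_normr_powR : 1 <= p -> continuous (fun x : R => `|x| `^ p).
Proof.
move=> p_ge1; have p0 : p != 0 by rewrite gt_eqF // (lt_le_trans ltr01).
move=> x; rewrite /continuous_at; have [->|x0] := eqVneq x 0.
  rewrite normr0 powR0 //.
  have norm0 : ((`|y| : R) @[y --> (0 : R)] --> (0 : R))%classic.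
    rewrite -[X in (_ --> X)%classic](normr0 R).
    by apply: cvg_norm; exact: cvg_id.
  apply: (squeeze_cvgr _ (cvg_cst 0) norm0).
  near=> y; rewrite powR_ge0 /= -[leRHS]powRr1 //.
  have [->|y0] := eqVneq y 0; first by rewrite normr0 !powR0 // oner_eq0.
  rewrite powRr1 // ge1r_powR // normr_gt0 y0 /=; near: y.
  exact: (cvgr_le _ norm0 _ ltr01).
have lnE (y : R) : y != 0 -> `|y| `^ p = expR (p * ln `|y|).
  by move=> y0; rewrite /powR normr_eq0 (negbTE y0).
rewrite lnE //.
apply: (@cvg_trans _ (expR (p * ln `|y|) @[y --> x])%classic).
  apply: near_eq_cvg; near=> y; rewrite lnE //; near: y.
  exact: (cvgr_neq0 x cvg_id x0).
have absx : (`|y| @[y --> x] --> `|x|)%classic.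
  by apply: cvg_norm; exact: cvg_id.
have lnx : {for `|x|, continuous (@ln R)}.
  by apply: continuous_ln; rewrite normr_gt0.
have plnx : (p * ln `|y| @[y --> x] --> p * ln `|x|)%classic.
  by apply: cvgMr; exact: (continuous_cvg _ lnx absx).
exact: (continuous_cvg _ (@continuous_expR R _) plnx).
Unshelve. all: by end_near.
Qed.

Lemma ltr_powR_exponent (a x y : R) : 1 < a -> x < y -> a `^ x < a `^ y.
Proof.
move=> a1 xy; rewrite /powR gt_eqF ?(lt_trans ltr01) // ltr_expR.
by rewrite ltr_pM2r // ln_gt0.
Qed.

(** Here t is the factor of [shrunk_row], A is the p-th power of the factor by
    which the vectors [normalized_row] are scaled, phi is the norm^p of a
    shrunk row and the second summand on the left of the first equation is
    the distance^p of two shrunk rows.  That equation says that the points of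
    [has_balanced_skew] are equidistant, the last one that their norm^p is half
    of the common distance^p.  Eliminating A leaves one equation F t = 0. *)
Lemma exists_balancing_parameters (n' : nat) (c := 2 `^ p)
    (n := n'.+1%:R : R) : 1 < p -> p < 2 ->
  n * (1 - c / 4) <= 1 -> 1 <= 2 * n * (1 - c / 4) ->
  exists t A : R, let phi := 1 + n'%:R * t `^ p in
    [/\ 0 <= t <= 1, 0 <= A,
        A * (c / 2 * n) + (t `^ p * (c / 2) * (n - 2) + (1 - t) `^ p
          + (1 + t) `^ p) = c * phi
      & A * n'%:R + phi = c / 2 * phi].
Proof.
move=> p1 p2 n_le n_ge.
have two_gt1 : 1 < 2 :> R by lra.
have p0 : p != 0 by rewrite gt_eqF // (lt_trans ltr01).
have c2 : 2 < c by rewrite -[ltLHS]powRr1 // /c ltr_powR_exponent.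
have c4 : c < 4.
  have -> : 4 = 2 `^ 2%:R :> R by rewrite powR_mulrn // -natrX.
  by rewrite /c ltr_powR_exponent.
have nE : n = n'%:R + 1 by rewrite /n -natr1.
(* For n = 1 the lower bound on n would force p <= 1. *)
have n'_gt0 : 0 < n'%:R :> R.
  rewrite ltr0n lt0n; apply/eqP => n'0.
  by move: n_ge; rewrite nE n'0; lra.
(* The absolute values make F continuous on the whole line; on [0, 1] they can
   be dropped. *)
pose F (t : R) :=
  let phi := 1 + n'%:R * `|t| `^ p in
  (c * phi - (`|t| `^ p * (c / 2) * (n - 2) + `|1 - t| `^ p + `|1 + t| `^ p))
    * n'%:R - (c / 2 - 1) * phi * (c / 2 * n).
have F_cont : continuous F.
  move=> t; rewrite /continuous_at /F /=.
  have C u (f : R -> R) : (f y @[y --> t] --> u)%classic ->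
      (`|f y| `^ p @[y --> t] --> `|u| `^ p)%classic.
    exact: (continuous_cvg _ (@continuous_normr_powR (ltW p1) u)).
  have idt : (y @[y --> t] --> t)%classic by exact: cvg_id.
  have Ct := C _ _ idt.
  have Cm : (`|1 - y| `^ p @[y --> t] --> `|1 - t| `^ p)%classic.
    by apply: (C _ (fun y => 1 - y)); apply: cvgB => //; exact: cvg_cst.
  have Cp : (`|1 + y| `^ p @[y --> t] --> `|1 + t| `^ p)%classic.
    by apply: (C _ (fun y => 1 + y)); apply: cvgD => //; exact: cvg_cst.
  by repeat first [exact: Ct | exact: Cm | exact: Cp | exact: cvg_cst
    | apply: cvgB | apply: cvgD | apply: cvgM].
have F0 : F 0 <= 0.
  rewrite /F /= normr0 powR0 // subr0 addr0 normr1 powR1.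
  have -> : (c * (1 + n'%:R * 0) - (0 * (c / 2) * (n - 2) + 1 + 1)) * n'%:R
     - (c / 2 - 1) * (1 + n'%:R * 0) * (c / 2 * n)
     = (c - 2) * (n * (1 - c / 4) - 1) by rewrite nE; field.
  by rewrite pmulr_rle0 ?subr_gt0 // subr_le0.
have F1 : 0 <= F 1.
  rewrite /F /= subrr normr0 powR0 // normr1 powR1.
  have -> : `|1 + 1 : R| `^ p = c by rewrite -[1 + 1]/(2 : R) normr_nat.
  have -> : (c * (1 + n'%:R * 1) - (1 * (c / 2) * (n - 2) + 0 + c)) * n'%:R
     - (c / 2 - 1) * (1 + n'%:R * 1) * (c / 2 * n)
     = c / 2 * n * (2 * n * (1 - c / 4) - 1) by rewrite nE; field.
  by rewrite mulr_ge0 ?subr_ge0 // mulr_ge0 ?ler0n //; lra.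
have F01 : Num.min (F 0) (F 1) <= 0 <= Num.max (F 0) (F 1).
  by rewrite ge_min F0 le_max F1 orbT.
have [t + Ft] := IVT ler01 (continuous_subspaceT F_cont) F01.
rewrite in_itv /= => /andP[t0 t1].
pose phi := 1 + n'%:R * t `^ p.
have phi_gt0 : 0 < phi.
  by rewrite /phi ltr_pwDl // mulr_ge0 ?powR_ge0 // ler0n.
exists t, ((c / 2 - 1) * phi / n'%:R); rewrite -/phi; split.
- by rewrite t0 t1.
- by rewrite divr_ge0 ?mulr_ge0 ?ler0n //; lra.
- have t1' : 0 <= 1 - t by lra.
  have t2' : 0 <= 1 + t by lra.
  move: Ft; rewrite /F /= !ger0_norm // -/phi => /eqP.
  rewrite subr_eq0 => /eqP Ft.
  apply: (mulIf (lt0r_neq0 n'_gt0)); rewrite mulrDl mulrAC divfK ?lt0r_neq0 //.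
  by rewrite -Ft -mulrDl subrK.
- by field; rewrite lt0r_neq0.
Qed.

End Tuning.

(** * The construction *)

Section Construction.
Variables (R : realType) (p : R).
Hypotheses (p_gt1 : 1 < p) (p_lt2 : p < 2).

(** The points are (a w_u, f_u) and (a w_u, - f_u).  The two points of one u are
    at distance^p 2 ^ p * phi; the sign between two different shrunk rows is
    irrelevant by [powsum_shrunk_rowB]. *)
Lemma has_balanced_skew (n' : nat) (H : 'M[R]_n'.+1) :
  skew_hadamard H ->
  n'.+1%:R * (1 - 2 `^ p / 4) <= 1 -> 1 <= 2 * n'.+1%:R * (1 - 2 `^ p / 4) ->
  has_balanced p (n' + n'.+1) (n'.+1 + n'.+1).
Proof.
move=> skH n_le n_ge; have p0 : 0 < p by rewrite (lt_trans ltr01).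
have [t [A /= [t01 A0 dist norm]]] :=
  exists_balancing_parameters p_gt1 p_lt2 n_le n_ge.
have /andP[t0 _] := t01.
pose phi := 1 + n'%:R * t `^ p; rewrite -/phi in dist norm.
have phi_gt0 : 0 < phi by rewrite /phi ltr_pwDl // mulr_ge0 ?powR_ge0 ?ler0n.
have c0 : 0 < 2 `^ p :> R by rewrite powR_gt0.
pose a := A `^ p^-1.
have aA : `|a| `^ p = A.
  by rewrite ger0_norm ?powR_ge0 // -powRrM mulVf ?gt_eqF // powRr1.
pose X (z : bool * 'I_n'.+1) : 'rV[R]_(n' + n'.+1) :=
  row_mx (a *: normalized_row H z.2) ((-1) ^+ z.1 *: shrunk_row H t z.2).
have signP (e : bool) : `|(-1) ^+ e : R| `^ p = 1.
  by rewrite normrX normrN1 expr1n powR1.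
have -> : (n'.+1 + n'.+1 = #|{: bool * 'I_n'.+1}|)%N.
  by rewrite card_prod card_bool card_ord mul2n addnn.
apply: (@has_balanced_rescale R p p0 _ _ X (2 `^ p / 2 * phi)).
- by rewrite mulr_gt0 ?divr_gt0.
- move=> [e u]; rewrite powsum_row_mx !powsumZ aA signP mul1r.
  by rewrite powsum_normalized_row // powsum_shrunk_row.
move=> [e u] [f v]; rewrite xpair_eqE negb_and /X /= => uv.
rewrite opp_row_mx add_row_mx powsum_row_mx -scalerBr powsumZ aA.
have [uv'|uv'] := eqVneq u v.
  move: uv; rewrite uv' eqxx orbF => ef.
  have -> : (-1) ^+ f = - (-1) ^+ e :> R.
    by move: e f ef => [] []; rewrite // expr0 expr1 ?opprK.
  rewrite subrr powsum0 // mulr0 add0r scaleNr opprK -scalerDl powsumZ.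
  have -> : (-1) ^+ e + (-1) ^+ e = 2 * (-1) ^+ e :> R by ring.
  rewrite powsum_shrunk_row // -/phi normrM normr_nat.
  by rewrite powRM ?normr_ge0 // signP mulr1; field.
have -> : (-1) ^+ e *: shrunk_row H t u - (-1) ^+ f *: shrunk_row H t v
  = (-1) ^+ e *: (shrunk_row H t u - (-1) ^+ (e (+) f) *: shrunk_row H t v).
  by rewrite scalerBr scalerA -signr_addb addKb.
rewrite powsumZ signP mul1r powsum_normalized_rowB // powsum_shrunk_rowB //.
  by rewrite dist; field.
by case: (e (+) f); [right|left].
Qed.

Lemma has_balanced_hadamard (k : nat) (c := 2 `^ p : R) :
  2 ^+ k * (1 - c / 4) <= 1 -> 1 <= 2 ^+ k.+1 * (1 - c / 4) ->
  has_balanced p (2 ^ k.+1).-1 (2 ^ k.+1).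
Proof.
have [H skH] := skew_hadamard_exists R k.
rewrite exprS -!natrX expnS mul2n -addnn.
case: (2 ^ k)%N (expn_gt0 2 k) H skH => // n' _ H skH.
exact: has_balanced_skew skH.
Qed.

(** The d + q points are q copies of the family of [has_balanced_hadamard] and
    one unit vector for each of the remaining d - q (2 ^ (k+1) - 1) dimensions;
    each copy gains one point over its dimension. *)
Lemma balanced_copies_leq_max (k d q : nat) (c := 2 `^ p : R) :
  2 ^+ k * (1 - c / 4) <= 1 -> 1 <= 2 ^+ k.+1 * (1 - c / 4) ->
  (q * (2 ^ k.+1).-1 <= d)%N -> (d + q <= max_equilateral p d)%N.
Proof.
move=> k_le k_ge qd; have p0 : 0 < p by rewrite (lt_trans ltr01).
have bal := has_balancedM p0 q (has_balanced_hadamard k_le k_ge).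
have := has_balancedD p0 bal
  (has_balancedM p0 (d - q * (2 ^ k.+1).-1)%N (has_balanced1 p)).
rewrite !muln1 subnKC // => /(has_balanced_leq_max p0 (ltW p_gt1)).
suff -> : (q * 2 ^ k.+1 + (d - q * (2 ^ k.+1).-1) = d + q)%N by [].
have := expn_gt0 2 k.+1; case: (2 ^ k.+1)%N qd => //= m; nia.
Qed.

End Construction.

Lemma log2_bounds (R : realType) (x : R) (k : int) : 0 < x ->
  k = Num.ceil (ln x^-1 / ln 2) - 1 -> 2 ^ k * x <= 1 /\ 1 <= 2 ^ (k + 1) * x.
Proof.
move=> x0 ->; have ln2 : 0 < ln 2 :> R by rewrite ln_gt0 // ltr1n.
have /andP[lo hi] := ceil_itv (ln x^-1 / ln 2).
have expE (z : int) : 2 ^ z * x = expR (z%:~R * ln 2 - ln x^-1).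
  rewrite lnV // opprK expRD lnK //; congr (_ * x).
  by rewrite -powR_intmul // /powR pnatr_eq0.
rewrite !expE subrK; split.
  by rewrite expR_le1 subr_le0 -ler_pdivlMr // ltW.
by rewrite -[leLHS]expR0 ler_expR subr_ge0 -ler_pdivrMr.
Qed.

Unset Implicit Arguments.

Theorem theorem2 (R : realType) (p : R) (hp1 : 1 < p) (hp2 : p < 2)
    (d : nat) (hd : (1 <= d)%N) (k : int)
    (hk : k = Num.ceil (ln ((1 - 2 `^ (p - 2))^-1) / ln 2) - 1) :
  Num.floor ((2 : R) ^ (k + 1) / ((2 : R) ^ (k + 1) - 1) * d%:R)
    <= (max_equilateral p d)%:Z
  /\ ((2 : R) ^ (k + 2) - 2 <= d%:R -> (d + 1 < max_equilateral p d)%N).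
Proof.
have cE : 2 `^ (p - 2) = 2 `^ p / 4 :> R.
  rewrite powRB ?pnatr_eq0 // ?implybT //; congr (_ / _).
  by rewrite powR_mulrn // -natrX.
have c_gt : 2 < 2 `^ p :> R.
  by rewrite -[ltLHS]powRr1 // ltr_powR_exponent ?ltr1n.
have c_lt : 2 `^ (p - 2) < 1 :> R.
  by rewrite -[ltRHS](powRr0 2) ltr_powR_exponent ?ltr1n // subr_lt0.
have x0 : 0 < 1 - 2 `^ (p - 2) :> R by rewrite subr_gt0.
have [k_le k_ge] := log2_bounds x0 hk.
(* p > 1 gives 1 - 2 `^ (p - 2) < 1 / 2, hence 2 ^ (k + 1) > 1. *)
have k_ge0 : 0 <= k.
  have : (2 : R) ^ 0 < 2 ^ (k + 1).
    rewrite expr0z ltNge; apply/negP => k1_le.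
    have : 2 ^ (k + 1) * (1 - 2 `^ (p - 2)) <= 1 - 2 `^ (p - 2) :> R.
      by rewrite ler_piMl // ltW.
    by lra.
  by rewrite ltr_eXz2l ?ltr1n // ltzD1.
case: k k_ge0 {hk} k_le k_ge => // k _; rewrite cE => k_le k_ge.
have e1 : Posz k + 1 = k.+1 by rewrite -PoszD addn1.
have e2 : Posz k + 2 = k.+2 by rewrite -PoszD addn2.
rewrite e1 in k_ge *; rewrite e2 -!exprnP -!natrX.
have large q := @balanced_copies_leq_max R p hp1 hp2 k d q k_le k_ge.
split.
  have M1 : (0 < (2 ^ k.+1).-1)%N.
    by rewrite -ltnS prednK ?expn_gt0 // -[1%N](expn0 2) ltn_exp2l.
  rewrite -ltzD1 floor_lt_int.
  have := large (d %/ (2 ^ k.+1).-1)%N (leq_divM _ _).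
  have := ltn_ceil d M1.
  case: (2 ^ k.+1)%N M1 => // -[//|m] _ /=.
  set q := (_ %/ _)%N => d_lt max_ge.
  rewrite -[m.+2%:R]natr1 addrK mulrAC ltr_pdivrMr ?ltr0n // natr1.
  rewrite -PoszD addn1 -!natrM ltr_nat; nia.
rewrite lerBlDr -natrD ler_nat expnS => d_ge.
by have := large 2%N; lia.
Qed.
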